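(* Let $m<n$ be positive integers, let $F:\mathbb{R}^n\to\mathbb{R}^m$, and let $\alpha\in(0,1)$. Consider the iteration $$x_{k+1}=\alpha x_k+(1-\alpha)\,T(x_k)J(x_k)x_k-T(x_k)F(x_k),\qquad k=0,1,2,\ldots,$$ where $J(x)$ is the Jacobian of $F$ at $x$ and $T(x)=J(x)^T\left(J(x)J(x)^T\right)^{-1}$, and assume that $J$ and $T$ are well defined at all the iterates $x_k$ and at the point $x^*$ below. If the iteration converges to a fixed point $x^*\in\mathbb{R}^n$, then $x^*$ satisfies the KKT optimality conditions of the problem of minimizing $x^Tx$ subject to $F(x)=0_{m\times 1}$, i.e. there exists $\lambda\in\mathbb{R}^m$ such that $$2x^*+J(x^* )^T\lambda=0_{n\times 1}\quad\text{and}\quad F(x^* )=0_{m\times 1}.$$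
   Context: $J(x)=\nabla F(x)\in\mathbb{R}^{m\times n}$ denotes the Jacobian matrix of $F$ at $x$; it is well defined when $F$ is differentiable at $x$. $T(x)=J(x)^T(J(x)J(x)^T)^{-1}\in\mathbb{R}^{n\times m}$ is the right inverse of $J(x)$; it is well defined when $J(x)J(x)^T$ is invertible. A fixed point of the iteration is a point $x^*$ satisfying $x^*=\alpha x^*+(1-\alpha)T(x^* )J(x^* )x^*-T(x^* )F(x^* )$. *)

(* Defs.v *)
From mathcomp Require Import all_boot all_order all_algebra.
From mathcomp Require Import all_classical all_reals all_analysis.
Set Implicit Arguments.
Unset Strict Implicit.
Unset Printing Implicit Defensive.
Import Order.TTheory GRing.Theory Num.Theory.
Import numFieldNormedType.Exports.
Local Open Scope classical_set_scope.
Local Open Scope ring_scope.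

(* The library's ['J f p] acts on row vectors by right multiplication, hence
   the transpositions: entry (i, j) of [Jac F x] is the partial derivative of
   the i-th component of [F] along the j-th coordinate; see [Jac_mulmx]. *)
Definition Jac (R : realType) (m n : nat) (F : 'cV[R]_n -> 'cV[R]_m)
    (x : 'cV[R]_n) : 'M[R]_(m, n) :=
  ('J (fun u : 'rV[R]_n => (F u^T)^T) x^T)^T.

Lemma continuous_trmx (R : realType) (m n : nat) :
  continuous (trmx : 'M[R]_(m, n) -> 'M[R]_(n, m)).
Proof.
move=> A B [P nP PB]; exists (fun i j => P j i) => [i j|M PM].
  by have := nP j i; rewrite mxE.
by apply: PB => i j; rewrite mxE; exact: PM.
Qed.

Lemma Jac_mulmx (R : realType) (m n : nat) (F : 'cV[R]_n -> 'cV[R]_m)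
    (x v : 'cV[R]_n) :
  differentiable F x -> Jac F x *m v = 'd F x v.
Proof.
move=> dF; have tr_diff p q (A : 'M[R]_(p, q)) : differentiable trmx A.
  exact/linear_differentiable/continuous_trmx.
have dtr p q (A : 'M[R]_(p, q)) : 'd trmx A = trmx
    :> ('M[R]_(p, q) -> 'M[R]_(q, p)).
  exact/diff_lin/continuous_trmx.
have dF' : differentiable F (x^T)^T by rewrite trmxK.
have dFT : differentiable (F \o trmx) x^T by exact: differentiable_comp.
rewrite /Jac /jacobian -{1}[v]trmxK -trmx_mul mul_rV_lin1 /=.
rewrite (diff_comp dFT (tr_diff _ _ _)) dtr /=.
by rewrite (diff_comp (tr_diff _ _ _) dF') dtr /= !trmxK.
Qed.

Definition rinvJac (R : realType) (m n : nat) (F : 'cV[R]_n -> 'cV[R]_m)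
    (x : 'cV[R]_n) : 'M[R]_(n, m) :=
  (Jac F x)^T *m invmx (Jac F x *m (Jac F x)^T).

(* ['d] and [invmx] are total; this says that [Jac F x] and [rinvJac F x]
   have their intended meaning at [x]. *)
Definition Jac_rinvJac_defined (R : realType) (m n : nat)
    (F : 'cV[R]_n -> 'cV[R]_m) (x : 'cV[R]_n) : Prop :=
  differentiable F x /\ Jac F x *m (Jac F x)^T \in unitmx.

Definition iter_map (R : realType) (m n : nat) (alpha : R)
    (F : 'cV[R]_n -> 'cV[R]_m) (x : 'cV[R]_n) : 'cV[R]_n :=
  alpha *: x + (1 - alpha) *: (rinvJac F x *m Jac F x *m x)
  - rinvJac F x *m F x.

Definition is_fixed_point (R : realType) (m n : nat) (alpha : R)
    (F : 'cV[R]_n -> 'cV[R]_m) (x : 'cV[R]_n) : Prop :=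
  x = iter_map alpha F x.

(* Main.v *)
Require Import Defs.
From mathcomp Require Import all_boot all_order all_algebra.
From mathcomp Require Import all_classical all_reals all_analysis.
Import Order.TTheory GRing.Theory Num.Theory.
Import numFieldNormedType.Exports.
Local Open Scope classical_set_scope.
Local Open Scope ring_scope.

(** The optimality conditions are encoded in the fixed point equation
[x = a x + (1 - a) T J x - T y] at [xstar], where [y = F xstar].  Since
[J T = 1], multiplying it on the left by [J] cancels the terms in [J x] and
leaves [y = 0], that is, feasibility.  What remains is
[(1 - a) (x - T J x) = 0], so [a < 1] gives [x = T J x]: the point is its own
orthogonal projection onto the row space of [J].  As [T = J^T (J J^T)^-1], this
displays [x] as [J^T] applied to [(J J^T)^-1 J x], and the multiplier is
[-2 (J J^T)^-1 J x]. *)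

Lemma Jac_mul_rinvJac (R : realType) (m n : nat) (F : 'cV[R]_n -> 'cV[R]_m)
    (x : 'cV[R]_n) :
  Jac F x *m (Jac F x)^T \in unitmx -> Jac F x *m rinvJac F x = 1%:M.
Proof. by move=> uG; rewrite /rinvJac mulmxA mulmxV. Qed.

(** Applying [J] to the fixed point equation separates the two contributions to
the correction: [J] kills [x - T J x] and sends [T y] to [y]. *)
Lemma fixed_point_split (K : fieldType) (m n : nat) (J : 'M[K]_(m, n))
    (T : 'M[K]_(n, m)) (a : K) (x : 'cV[K]_n) (y : 'cV[K]_m) :
  J *m T = 1%:M -> a != 1 ->
  x = a *: x + (1 - a) *: (T *m J *m x) - T *m y ->
  y = 0 /\ x = T *m J *m x.
Proof.
move=> JT a_neq1 fix_x.
have y0 : y = 0.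
  move: (congr1 (mulmx J) fix_x).
  rewrite mulmxBr mulmxDr -!scalemxAr !mulmxA JT !mul1mx -scalerDl.
  rewrite subrKC scale1r => /eqP.
  by rewrite eq_sym -subr_eq0 addrAC subrr add0r oppr_eq0 => /eqP.
split=> //; apply/eqP; rewrite -subr_eq0.
have : (1 - a) *: (x - T *m J *m x) = 0.
  rewrite scalerBr scalerBl scale1r {1}fix_x y0 mulmx0 subr0.
  by rewrite addrAC addrK subrr.
by move/eqP; rewrite scaler_eq0 (subr_eq0 1 a) (eq_sym 1) (negPf a_neq1).
Qed.

Theorem mainTheorem1 (R : realType) (m n : nat) (m_gt0 : (0 < m)%N)
    (lt_mn : (m < n)%N) (F : 'cV[R]_n -> 'cV[R]_m)
    (alpha : R) (alpha_gt0 : 0 < alpha) (alpha_lt1 : alpha < 1)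
    (x : nat -> 'cV[R]_n) (xstar : 'cV[R]_n)
    (x_defined : forall k : nat, Jac_rinvJac_defined F (x k))
    (xstar_defined : Jac_rinvJac_defined F xstar)
    (x_iter : forall k : nat, x k.+1 = iter_map alpha F (x k))
    (x_cvg : x k @[k --> \oo] --> xstar)
    (xstar_fixed : is_fixed_point alpha F xstar) :
  exists lambda : 'cV[R]_m,
    2 *: xstar + (Jac F xstar)^T *m lambda = 0 /\ F xstar = 0.
Proof.
have [_ uG] := xstar_defined.
have [F0 xE] := fixed_point_split _ _ _ _ _ _ _ _
  (Jac_mul_rinvJac _ _ _ _ _ uG) (negbT (lt_eqF alpha_lt1))
  xstar_fixed.
exists (- (2 *: (invmx (Jac F xstar *m (Jac F xstar)^T) *m Jac F xstar
                 *m xstar))); split=> //.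
by rewrite mulmxN -scalemxAr !mulmxA -/(rinvJac F xstar) -xE subrr.
Qed.
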